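(* Let $\Phi$ be a root system of type $B_n$, $C_n$ or $D_n$. Let $\mathcal{G}$ be a $\Phi$-graph with Coxeter graphical zonotope $Z_{\mathcal{G}}\subset\mathbb{R}^n$. Then $x\in\mathbb{R}^n$ is a mean score sequence of a random Coxeter tournament on $\mathcal{G}$ if and only if $x\in Z_{\mathcal{G}}$.
   Context: Write $[n]=\{1,\dots,n\}$ and let $e_1,\dots,e_n$ be the standard basis of $\mathbb{R}^n$. A (simple) signed graph $\mathcal{G}$ on $[n]$ consists of a set of negative edges $E^-\subseteq\binom{[n]}{2}$, a set of positive edges $E^+\subseteq\binom{[n]}{2}$ (not necessarily disjoint from $E^-$), a set of half-edges $H\subseteq[n]$ and a set of loops $L\subseteq[n]$. For $\Phi$ of type $B_n$, $C_n$ or $D_n$, a $\Phi$-graph is a signed graph with: $L=\emptyset$ if $\Phi=B_n$; $H=\emptyset$ if $\Phi=C_n$; $H=L=\emptyset$ if $\Phi=D_n$. To $\mathcal{G}$ one associates the set of vectors (positive roots) $$\Gamma(\mathcal{G})=\{e_i-e_j: ij\in E^-,\ i>j\}\cup\{e_i+e_j: ij\in E^+,\ i>j\}\cup\{e_i: i\in H\}\cup\{2e_i: i\in L\}.$$ The Coxeter graphical zonotope of $\mathcal{G}$ is the Minkowski sum of segments $Z_{\mathcal{G}}=\sum_{\alpha\in\Gamma(\mathcal{G})}[-\alpha/2,\alpha/2]$. A random Coxeter tournament on $\mathcal{G}$ is a collection of numbers in $[0,1]$: $p_{ij}^-=1-p_{ji}^-$ for each $ij\in E^-$; $p_{ij}^+=p_{ji}^+$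 for each $ij\in E^+$; $p_i^h$ for each $i\in H$; $p_i^\ell$ for each $i\in L$. Its mean score sequence is the vector $x\in\mathbb{R}^n$ with coordinates $$x_i=\sum_{j:\,ij\in E^-}(p_{ij}^--\tfrac12)+\sum_{j:\,ij\in E^+}(p_{ij}^+-\tfrac12)+\mathbf{1}_{i\in H}(p_i^h-\tfrac12)+\mathbf{1}_{i\in L}\,2(p_i^\ell-\tfrac12).$$ *)

(* Defs.v *)
From HB Require Import structures.
From mathcomp Require Import all_boot all_order all_algebra finmap.
From mathcomp Require Import boolp classical_sets reals.
Set Implicit Arguments.
Unset Strict Implicit.
Unset Printing Implicit Defensive.
Import Order.TTheory GRing.Theory Num.Theory.
Local Open Scope ring_scope.

(* The vertex set [n] = {1, ..., n} is modelled by 'I_n = {0, ..., n - 1}, and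
   an edge ij by the two-element set [set i; j]. *)
Record signed_graph (n : nat) := SignedGraph {
  neg_edges : {set {set 'I_n}};
  pos_edges : {set {set 'I_n}};
  half_edges : {set 'I_n};
  loops : {set 'I_n};
  card_neg_edge : forall e, e \in neg_edges -> #|e| = 2%N;
  card_pos_edge : forall e, e \in pos_edges -> #|e| = 2%N
}.

Definition neg_adj n (G : signed_graph n) (i j : 'I_n) : bool :=
  [set i; j]%SET \in neg_edges G.

Definition pos_adj n (G : signed_graph n) (i j : 'I_n) : bool :=
  [set i; j]%SET \in pos_edges G.

Variant coxeter_type := TypeB | TypeC | TypeD.

Definition is_coxeter_graph (Phi : coxeter_type) n (G : signed_graph n) : Prop :=
  match Phi with
  | TypeB => loops G = finset.set0
  | TypeC => half_edges G = finset.set0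
  | TypeD => half_edges G = finset.set0 /\ loops G = finset.set0
  end.

Definition std_basis (R : realType) n (i : 'I_n) : 'rV[R]_n := delta_mx 0 i.

Definition positive_roots (R : realType) n (G : signed_graph n) : {fset 'rV[R]_n} :=
  ([fset (std_basis R i - std_basis R j)%R
      | i : 'I_n, j : 'I_n & neg_adj G i j && (j < i)%N] `|`
   [fset (std_basis R i + std_basis R j)%R
      | i : 'I_n, j : 'I_n & pos_adj G i j && (j < i)%N] `|`
   [fset std_basis R i | i in half_edges G] `|`
   [fset 2 *: std_basis R i | i in loops G])%fset.

Definition segment (R : realType) n (u v : 'rV[R]_n) : set 'rV[R]_n :=
  [set (1 - t) *: u + t *: v | t in [set t : R | 0 <= t <= 1]]%classic.

Definition minkowski_add (R : realType) n (A B : set 'rV[R]_n) :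
    set 'rV[R]_n :=
  [set a + b | a in A & b in B]%classic.

(* Minkowski addition is commutative, so the iterated sum below does not depend
   on the order in which the finite set of roots is enumerated. *)
Lemma minkowski_addA (R : realType) n : associative (@minkowski_add R n).
Proof.
move=> A B C; apply/seteqP; split => x.
  case=> a Aa [_ [b Bb [c Cc <-]] <-].
  by exists (a + b); [exists a => //; exists b | exists c; rewrite ?addrA].
case=> _ [a Aa [b Bb <-]] [c Cc <-]; exists a => //.
by exists (b + c); [exists b => //; exists c | rewrite addrA].
Qed.

Lemma minkowski_addC (R : realType) n : commutative (@minkowski_add R n).
Proof.
by move=> A B; apply/seteqP; split => x [a Aa [b Bb <-]];
  exists b => //; exists a => //; rewrite addrC.
Qed.

Lemma minkowski_add0 (R : realType) n :
  left_id [set 0]%classic (@minkowski_add R n).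
Proof.
move=> A; apply/seteqP; split => x; first by case=> _ -> [b Bb <-]; rewrite add0r.
by move=> Ax; exists 0 => //; exists x => //; rewrite add0r.
Qed.

HB.instance Definition _ (R : realType) n :=
  Monoid.isComLaw.Build (set 'rV[R]_n) [set 0]%classic (@minkowski_add R n)
    (@minkowski_addA R n) (@minkowski_addC R n) (@minkowski_add0 R n).

Definition zonotope (R : realType) n (G : signed_graph n) : set 'rV[R]_n :=
  \big[@minkowski_add R n/[set 0]%classic]_(a <- positive_roots R G)
    segment (- (2^-1 *: a)) (2^-1 *: a).
Arguments zonotope R {n} G _.

(* A collection of numbers indexed by the edges of G is given by functions on
   all (pairs of) vertices; their values away from the edges of G are
   unconstrained and do not enter the mean score sequence. *)
Record tournament (R : realType) n (G : signed_graph n) := Tournament {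
  p_neg : 'I_n -> 'I_n -> R;
  p_pos : 'I_n -> 'I_n -> R;
  p_half : 'I_n -> R;
  p_loop : 'I_n -> R;
  p_neg01 : forall i j, neg_adj G i j -> 0 <= p_neg i j <= 1;
  p_negC : forall i j, neg_adj G i j -> p_neg i j = 1 - p_neg j i;
  p_pos01 : forall i j, pos_adj G i j -> 0 <= p_pos i j <= 1;
  p_posC : forall i j, pos_adj G i j -> p_pos i j = p_pos j i;
  p_half01 : forall i, i \in half_edges G -> 0 <= p_half i <= 1;
  p_loop01 : forall i, i \in loops G -> 0 <= p_loop i <= 1
}.

Definition mean_score (R : realType) n (G : signed_graph n)
    (T : tournament R G) : 'rV[R]_n :=
  \row_i (\sum_(j | neg_adj G i j) (p_neg T i j - 2^-1)
        + \sum_(j | pos_adj G i j) (p_pos T i j - 2^-1)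
        + (if i \in half_edges G then p_half T i - 2^-1 else 0)
        + (if i \in loops G then 2 * (p_loop T i - 2^-1) else 0)).

(* Main.v *)
Require Import Defs.
From mathcomp Require Import all_boot all_order all_algebra finmap lra.
From mathcomp Require Import boolp classical_sets reals.
Set Implicit Arguments.
Unset Strict Implicit.
Unset Printing Implicit Defensive.
Import Order.TTheory GRing.Theory Num.Theory.
Local Open Scope ring_scope.

(** A point of the segment [-a/2, a/2] is (t - 1/2) a for some t in [0,1], so
    choosing a point in every summand of the zonotope amounts to choosing a
    number in [0,1] for every root, that is, for every edge.  A tournament
    makes exactly such a choice: an edge ij carries two numbers, but one
    determines the other, and the theorem says that mean scores are the points
    of the zonotope with t the edge probability.

    Why the scores match: for a negative edge with i > j, the excess of i is
    p_ij - 1/2 and that of j is p_ji - 1/2 = -(p_ij - 1/2), so together they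
    contribute (p_ij - 1/2)(e_i - e_j).  A positive edge gives both endpoints
    the same excess and contributes (p_ij - 1/2)(e_i + e_j); half-edges and
    loops contribute multiples of e_i and 2 e_i.  Summing over all edges gives
    [mean_scoreE], whose core is the double count [sum_oriented_edges].

    The zonotope is a sum over the set of roots, whereas the mean score is a
    sum over edges.  The two agree because different edges have different roots
    ([edge_root_inj]); this yields the description [zonotopeP] of the zonotope
    by edge coefficients.  Conversely [edge_prob_surj] builds a tournament with
    prescribed edge probabilities. *)

(** Candidate edges: negative, positive, half-edge, loop.  For the first two,
    an edge is represented by the pair (larger endpoint, smaller endpoint), an
    order imposed by [is_edge]. *)
Definition edge_index (n : nat) : finType :=
  ('I_n * 'I_n + 'I_n * 'I_n + ('I_n + 'I_n))%type.

Definition is_edge n (G : signed_graph n) (k : edge_index n) : bool :=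
  match k with
  | inl (inl (i, j)) => neg_adj G i j && (j < i)%N
  | inl (inr (i, j)) => pos_adj G i j && (j < i)%N
  | inr (inl i) => i \in half_edges G
  | inr (inr i) => i \in loops G
  end.

Definition edge_root (R : realType) n (k : edge_index n) : 'rV[R]_n :=
  match k with
  | inl (inl (i, j)) => std_basis R i - std_basis R j
  | inl (inr (i, j)) => std_basis R i + std_basis R j
  | inr (inl i) => std_basis R i
  | inr (inr i) => 2 *: std_basis R i
  end.

Lemma positive_rootsE (R : realType) n (G : signed_graph n) :
  positive_roots R G = [fset edge_root R k | k : edge_index n & is_edge G k]%fset.
Proof.
apply/fsetP => a; rewrite !in_fsetU; apply/idP/imfsetP => /=.
  case/orP => [/orP[/orP[]|]|].
  - by case/imfset2P => i _ [j e ->]; exists (inl (inl (i, j))).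
  - by case/imfset2P => i _ [j e ->]; exists (inl (inr (i, j))).
  - by case/imfsetP => i /= e ->; exists (inr (inl i)).
  - by case/imfsetP => i /= e ->; exists (inr (inr i)).
case=> -[[[i j]|[i j]]|[i|i]] e ->; apply/orP.
- by left; apply/orP; left; apply/orP; left; apply/imfset2P; exists i => //; exists j.
- by left; apply/orP; left; apply/orP; right; apply/imfset2P; exists i => //; exists j.
- by left; apply/orP; right; apply/imfsetP; exists i.
- by right; apply/imfsetP; exists i.
Qed.

(** The coordinate sums 0, 2, 1, 2 of the four kinds of roots tell the kinds
    apart, except positive edges from loops; there the coordinate at the larger
    endpoint of the positive edge is 1, while 2 e_k has entries 0 and 2.  For
    two roots of the same kind, the entries at the endpoints recover the edge,
    the orientation i > j excluding e_i + e_j = e_j + e_i. *)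
Lemma edge_root_inj (R : realType) n (G : signed_graph n) :
  {in [pred k | is_edge G k] &, injective (@edge_root R n)}.
Proof.
have ltF (i j : 'I_n) : (j < i)%N -> (i == j) = false /\ (j == i) = false.
  by move=> lt_ji; split; apply/negbTE; rewrite neq_ltn lt_ji ?orbT.
pose total (v : 'rV[R]_n) := \sum_m v 0 m.
have totalB (i : 'I_n) : total (std_basis R i) = 1.
  rewrite /total (bigD1 i) //= mxE !eqxx big1 ?addr0 // => m /negbTE ne.
  by rewrite mxE ne.
have totalD u v : total (u + v) = total u + total v.
  by rewrite /total -big_split; apply: eq_bigr => m _; rewrite mxE.
have totalZ c u : total (c *: u) = c * total u.
  by rewrite /total mulr_sumr; apply: eq_bigr => m _; rewrite mxE.
have totalN u : total (- u) = - total u by rewrite -scaleN1r totalZ mulN1r.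
move=> k l Pk Pl eq_kl.
have eq_at m : edge_root R k 0 m = edge_root R l 0 m by rewrite eq_kl.
move: (congr1 total eq_kl) eq_at Pk Pl => {eq_kl}.
case: k l => [[[i j]|[i j]]|[i|i]] [[[k l]|[k l]]|[k|k]] /=;
  rewrite ?(totalD, totalN, totalZ, totalB) => tot; try by exfalso; lra.
- move=> eq_at /andP[_ lt_ji] /andP[_ lt_lk].
  have [ij ji] := ltF _ _ lt_ji.
  move: (eq_at i) (eq_at j); rewrite !mxE !eqxx /= ij ji.
  case: (i =P k) => [<-|_]; case: (j =P l) => [<-|_] //;
    rewrite /= ?ij ?ji ?mulr1n ?mulr0n; case: (i == l); case: (j == k);
    rewrite /= ?mulr1n ?mulr0n => *; exfalso; lra.
- move=> eq_at /andP[_ lt_ji] /andP[_ lt_lk].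
  have [ij ji] := ltF _ _ lt_ji.
  move: (eq_at i) (eq_at j); rewrite !mxE !eqxx /= ij ji.
  case: (i =P k) => [<-|_].
    by rewrite ji; case: (j =P l) => [<- //|_] _ /= *; exfalso; lra.
  case: (i =P l) => [il|_]; last by move=> /= *; exfalso; lra.
  case: (j =P k) => [jk|_]; first by move: lt_lk; rewrite -il -jk ltnNge ltnW.
  by rewrite -il ji /= => *; exfalso; lra.
- move=> /(_ i) + /andP[_ /ltF[ij _]].
  by rewrite !mxE !eqxx /= ij; case: (i == k) => /= *; exfalso; lra.
- by move=> /(_ i); rewrite !mxE !eqxx; case: (i =P k) => [-> //|_] /= *; exfalso; lra.
- move=> /(_ k) + _ /andP[_ /ltF[kl _]].
  by rewrite !mxE !eqxx /= kl; case: (k == i) => /= *; exfalso; lra.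
- by move=> /(_ i); rewrite !mxE !eqxx; case: (i =P k) => [-> //|_] /= *; exfalso; lra.
Qed.

(** Presenting the summands as images makes the parameters of the chosen
    points part of the membership, so that no choice is needed to recover them.
    Distinct indices allow those parameters to be gathered into one function. *)
Lemma minkowski_sum_imageP (R : realType) n (I : eqType) (T : Type)
    (D : I -> set T) (g : I -> T -> 'rV[R]_n) (t0 : T) (s : seq I) x :
  uniq s ->
  (\big[@minkowski_add R n/[set 0]%classic]_(k <- s)
      [set g k t | t in D k]%classic) x <->
  exists2 t : I -> T, {in s, forall k, D k (t k)} & x = \sum_(k <- s) g k (t k).
Proof.
elim: s x => [|k s IH] x /=.
  rewrite big_nil => _; split=> [->|[t _ ->]]; last by rewrite big_nil.
  by exists (fun=> t0); rewrite ?big_nil.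
case/andP=> k_notin_s uniq_s; rewrite big_cons; split.
  case=> _ [u Du <-] [b /(IH _ uniq_s)[t Dt ->] <-].
  pose t' j := if j == k then u else t j.
  have t's : {in s, t' =1 t}.
    by move=> j js; rewrite /t'; case: eqP => // eq_jk; rewrite -eq_jk js in k_notin_s.
  exists t'.
    move=> j; rewrite inE => /orP[/eqP->|js]; first by rewrite /t' eqxx.
    by rewrite t's //; apply: Dt.
  rewrite big_cons {1}/t' eqxx; congr (_ + _).
  by rewrite !big_seq; apply: eq_bigr => j /t's ->.
case=> t Dt ->; rewrite big_cons; exists (g k (t k)).
  by exists (t k) => //; apply: Dt; rewrite mem_head.
exists (\sum_(j <- s) g j (t j)) => //; apply/IH => //; exists t => // j js.
by apply: Dt; rewrite inE js orbT.
Qed.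

Lemma segment_centered (R : realType) n (a : 'rV[R]_n) :
  segment (- (2^-1 *: a)) (2^-1 *: a) =
  [set (t - 2^-1) *: a | t in [set t : R | 0 <= t <= 1]]%classic.
Proof.
rewrite /segment; congr image; apply/funext => t.
by rewrite -scaleNr !scalerA -scalerDl; congr (_ *: _); lra.
Qed.

Lemma zonotopeP (R : realType) n (G : signed_graph n) (x : 'rV[R]_n) :
  zonotope R G x <->
  exists2 t : edge_index n -> R, forall k, is_edge G k -> 0 <= t k <= 1
    & x = \sum_(k | is_edge G k) (t k - 2^-1) *: edge_root R k.
Proof.
rewrite /zonotope positive_rootsE.
under eq_bigr do rewrite segment_centered.
rewrite big_imfset; last exact: edge_root_inj.
set s := enum_finmem _.
have mem_s k : (k \in s) = is_edge G k by rewrite enum_finmemE inE.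
have uniq_s : uniq s := enum_finmem_uniq _.
have sumE (F : edge_index n -> 'rV[R]_n) :
    \sum_(k <- s) F k = \sum_(k | is_edge G k) F k.
  rewrite -[RHS]big_enum; apply: perm_big; apply: uniq_perm; rewrite ?enum_uniq //.
  by move=> k; rewrite mem_s mem_enum.
split.
  case/(minkowski_sum_imageP _ (fun k t => (t - 2^-1) *: edge_root R k) 0 _ uniq_s).
  by move=> t t01 ->; exists t => [k|]; [rewrite -mem_s; apply: t01 | rewrite sumE].
case=> t t01 ->.
apply/(minkowski_sum_imageP _ (fun k t => (t - 2^-1) *: edge_root R k) 0 _ uniq_s).
by exists t => [k|]; [rewrite mem_s; apply: t01 | rewrite sumE].
Qed.

(** Both endpoints of an edge are counted on the right: the ordered pairs with
    j < i give the e_i terms, and those with i < j, read backwards, give the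
    s e_j terms.  Negative edges correspond to s = -1, positive ones to s = 1. *)
Lemma sum_oriented_edges (R : realType) n (adj : rel 'I_n) (s : R)
    (w : 'I_n -> 'I_n -> R) :
  symmetric adj -> irreflexive adj ->
  (forall i j, adj i j -> w j i = s * w i j) ->
  \sum_(p | adj p.1 p.2 && (p.2 < p.1)%N)
      w p.1 p.2 *: (std_basis R p.1 + s *: std_basis R p.2)
  = \row_i \sum_(j | adj i j) w i j.
Proof.
move=> adjC adjF ws.
have swapK : involutive (fun p : 'I_n * 'I_n => (p.2, p.1)) by case.
rewrite [RHS]row_sum_delta.
under [RHS]eq_bigr do rewrite mxE scaler_suml.
rewrite pair_big_dep [RHS](bigID (fun p : 'I_n * 'I_n => (p.2 < p.1)%N)) /=.
under [LHS]eq_bigr do rewrite scalerDr.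
rewrite big_split /=; congr (_ + _).
rewrite [RHS](reindex_inj (inv_inj swapK)) /=.
apply: eq_big => [[i j]|[i j]] /=.
  rewrite adjC; case: (boolP (adj j i)) => //= adj_ji.
  rewrite -leqNgt ltn_neqAle; case: eqP => // /val_inj eq_ji.
  by rewrite eq_ji adjF in adj_ji.
by case/andP=> adj_ij _; rewrite (ws _ _ adj_ij) scalerA mulrC.
Qed.

Lemma neg_adjC n (G : signed_graph n) : symmetric (neg_adj G).
Proof. by move=> i j; rewrite /neg_adj finset.setUC. Qed.

Lemma pos_adjC n (G : signed_graph n) : symmetric (pos_adj G).
Proof. by move=> i j; rewrite /pos_adj finset.setUC. Qed.

Lemma neg_adjF n (G : signed_graph n) : irreflexive (neg_adj G).
Proof.
move=> i; apply/negP => /card_neg_edge.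
by rewrite finset.setUid finset.cards1.
Qed.

Lemma pos_adjF n (G : signed_graph n) : irreflexive (pos_adj G).
Proof.
move=> i; apply/negP => /card_pos_edge.
by rewrite finset.setUid finset.cards1.
Qed.

Definition edge_prob (R : realType) n (G : signed_graph n)
    (T : tournament R G) (k : edge_index n) : R :=
  match k with
  | inl (inl (i, j)) => p_neg T i j
  | inl (inr (i, j)) => p_pos T i j
  | inr (inl i) => p_half T i
  | inr (inr i) => p_loop T i
  end.

Lemma edge_prob01 (R : realType) n (G : signed_graph n) (T : tournament R G) k :
  is_edge G k -> 0 <= edge_prob T k <= 1.
Proof.
case: k => [[[i j]|[i j]]|[i|i]] /=.
- by case/andP=> /(p_neg01 T).
- by case/andP=> /(p_pos01 T).
- exact: p_half01.
- exact: p_loop01.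
Qed.

(** The link between tournaments and zonotopes: the scores, defined vertex by
    vertex, regroup edge by edge into multiples of the roots. *)
Lemma mean_scoreE (R : realType) n (G : signed_graph n) (T : tournament R G) :
  mean_score T =
  \sum_(k | is_edge G k) (edge_prob T k - 2^-1) *: edge_root R k.
Proof.
rewrite big_sumType /= !big_sumType /=.
have -> : mean_score T =
    \row_i \sum_(j | neg_adj G i j) (p_neg T i j - 2^-1)
    + \row_i \sum_(j | pos_adj G i j) (p_pos T i j - 2^-1)
    + (\row_i (if i \in half_edges G then p_half T i - 2^-1 else 0)
       + \row_i (if i \in loops G then 2 * (p_loop T i - 2^-1) else 0)).
  by apply/rowP => i; rewrite !mxE addrA.
congr (_ + _ + (_ + _)).
- rewrite -(@sum_oriented_edges _ _ _ (-1)).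
  + by apply: eq_big => [[i j]|[i j] _] //=; rewrite scaleN1r.
  + exact: neg_adjC.
  + exact: neg_adjF.
  + by move=> i j /(p_negC T) ->; lra.
- rewrite -(@sum_oriented_edges _ _ _ 1).
  + by apply: eq_big => [[i j]|[i j] _] //=; rewrite scale1r.
  + exact: pos_adjC.
  + exact: pos_adjF.
  + by move=> i j /(p_posC T) ->; rewrite mul1r.
- rewrite [LHS]row_sum_delta [RHS]big_mkcond; apply: eq_bigr => i _.
  by rewrite mxE; case: ifP => // _; rewrite scale0r.
- rewrite [LHS]row_sum_delta [RHS]big_mkcond; apply: eq_bigr => i _.
  by rewrite mxE; case: ifP => _; rewrite ?scale0r // scalerA mulrC.
Qed.

(** The relation between p_ij and p_ji forces the values on pairs with i < j
    once those with i > j are given, and it preserves [0,1]. *)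
Lemma edge_prob_surj (R : realType) n (G : signed_graph n)
    (t : edge_index n -> R) :
  (forall k, is_edge G k -> 0 <= t k <= 1) ->
  exists T : tournament R G, {in [pred k | is_edge G k], edge_prob T =1 t}.
Proof.
move=> t01.
pose neg (i j : 'I_n) := if (j < i)%N then t (inl (inl (i, j))) else 1 - t (inl (inl (j, i))).
pose pos (i j : 'I_n) := if (j < i)%N then t (inl (inr (i, j))) else t (inl (inr (j, i))).
have lt_swap (i j : 'I_n) : i != j -> (j < i)%N = false -> (i < j)%N.
  by move=> ne_ij /negbT; rewrite -leqNgt leq_eqVlt (inj_eq val_inj) (negbTE ne_ij).
have neq_neg i j : neg_adj G i j -> i != j.
  by apply: contraTneq => ->; rewrite neg_adjF.
have neq_pos i j : pos_adj G i j -> i != j.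
  by apply: contraTneq => ->; rewrite pos_adjF.
have neg01 i j : neg_adj G i j -> 0 <= neg i j <= 1.
  rewrite /neg => adj_ij; case: ifP => [lt_ji|/(lt_swap _ _ (neq_neg _ _ adj_ij)) lt_ij].
    by apply: t01; rewrite /= adj_ij.
  have /t01 : is_edge G (inl (inl (j, i))) by rewrite /= neg_adjC adj_ij.
  by lra.
have negC i j : neg_adj G i j -> neg i j = 1 - neg j i.
  by move/neq_neg; rewrite /neg neq_ltn => /orP[] lt; rewrite lt ltnNge ltnW //= subKr.
have pos01 i j : pos_adj G i j -> 0 <= pos i j <= 1.
  rewrite /pos => adj_ij; case: ifP => [lt_ji|/(lt_swap _ _ (neq_pos _ _ adj_ij)) lt_ij].
    by apply: t01; rewrite /= adj_ij.
  by apply: t01; rewrite /= pos_adjC adj_ij.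
have posC i j : pos_adj G i j -> pos i j = pos j i.
  by move/neq_pos; rewrite /pos neq_ltn => /orP[] lt; rewrite lt ltnNge ltnW.
exists (@Tournament R n G neg pos (fun i => t (inr (inl i))) (fun i => t (inr (inr i)))
  neg01 negC pos01 posC (fun i => t01 (inr (inl i))) (fun i => t01 (inr (inr i)))).
by move=> [[[i j]|[i j]]|[i|i]] //=; rewrite inE /= => /andP[_ lt_ji];
  rewrite /neg /pos lt_ji.
Qed.

Theorem theorem3p1 (R : realType) (n : nat) (Phi : coxeter_type)
    (G : signed_graph n) (hG : is_coxeter_graph Phi G) (x : 'rV[R]_n) :
  (exists T : tournament R G, mean_score T = x) <-> zonotope R G x.
Proof.
split=> [[T <-]|/zonotopeP[t t01 ->]].
  apply/zonotopeP; exists (edge_prob T); last exact: mean_scoreE.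
  exact: edge_prob01.
have [T Tt] := edge_prob_surj t01; exists T.
by rewrite mean_scoreE; apply: eq_bigr => k /Tt ->.
Qed.
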